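(* Let $R$ be a left (or right) artinian aic-semiring with $1\neq 0$. Then $R$ is ideal-simple if and only if $R$ is a division aic-semiring.
   Context: A semiring $(R,+,\cdot,0,1)$ consists of a commutative monoid $(R,+,0)$ and a monoid $(R,\cdot,1)$ such that multiplication distributes over addition on both sides and $0r=0=r0$ for all $r\in R$. An ideal (left, right ideal) is an additive submonoid closed under two-sided (left, right) multiplication by elements of $R$; $R$ is ideal-simple if $0$ and $R$ are its only ideals; $R$ is left (right) artinian if its left (right) ideals satisfy the descending chain condition. $R$ is additively idempotent if $x+x=x$ for all $x$; then $x\le y\iff x+y=y$ is a partial order. An additively idempotent semiring is an aic-semiring (additively idempotent chain semiring) if this order is total. A division aic-semiring is an aic-semiring in which every nonzero element has a two-sided multiplicative inverse. *)

(* Defs.v *)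
From HB Require Import structures.
From mathcomp Require Import all_boot all_order all_algebra.
From mathcomp Require Import boolp classical_sets.

Set Implicit Arguments.
Unset Strict Implicit.
Unset Printing Implicit Defensive.

Import GRing.Theory.

Local Open Scope classical_set_scope.
Local Open Scope ring_scope.

Definition additive_submonoid (R : pzSemiRingType) (I : set R) : Prop :=
  I 0 /\ forall x y, I x -> I y -> I (x + y).

Definition left_ideal (R : pzSemiRingType) (I : set R) : Prop :=
  additive_submonoid I /\ forall r x, I x -> I (r * x).

Definition right_ideal (R : pzSemiRingType) (I : set R) : Prop :=
  additive_submonoid I /\ forall r x, I x -> I (x * r).

Definition ideal (R : pzSemiRingType) (I : set R) : Prop :=
  left_ideal I /\ right_ideal I.

Definition ideal_simple (R : pzSemiRingType) : Prop :=
  forall I : set R, ideal I -> I = [set 0] \/ I = [set: R].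

Definition descending_chain_condition (T : Type) (P : set T -> Prop) : Prop :=
  forall I : nat -> set T,
    (forall n, P (I n)) -> (forall n, I n.+1 `<=` I n) ->
    exists N, forall n, (N <= n)%N -> I n = I N.

Definition left_artinian (R : pzSemiRingType) : Prop :=
  descending_chain_condition (@left_ideal R).

Definition right_artinian (R : pzSemiRingType) : Prop :=
  descending_chain_condition (@right_ideal R).

Definition additively_idempotent (R : pzSemiRingType) : Prop :=
  forall x : R, x + x = x.

(* A partial order when R is additively idempotent. *)
Definition add_le (R : pzSemiRingType) : rel R := fun x y => x + y == y.

Definition aic_semiring (R : pzSemiRingType) : Prop :=
  additively_idempotent R /\ total (@add_le R).

Definition division_aic_semiring (R : pzSemiRingType) : Prop :=
  aic_semiring R /\
  forall x : R, x != 0 -> exists y : R, x * y = 1 /\ y * x = 1.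

(* Main.v *)
Require Import Defs.
From mathcomp Require Import all_boot all_order all_algebra.
From mathcomp Require Import boolp classical_sets.

(** In a chain semiring [x + y] is [x] or [y], so [RxR = {axb}] is already an
    ideal. If [R] is ideal-simple and [x != 0] then [axb = 1] for some [a], [b].
    If [cb = 1], stabilisation of the chain [R ⊇ Rc ⊇ Rc^2 ⊇ ...] gives
    [c^n = r c^(n+1)], and multiplying by [b^n] on the right gives [rc = 1]:
    one-sided inverses are two-sided. Hence [ba] is the inverse of [x]. *)

Import GRing.Theory.

Local Open Scope ring_scope.

Lemma expr_left_inverse {R : pzSemiRingType} (b c : R) n :
  c * b = 1 -> c ^+ n * b ^+ n = 1.
Proof.
move=> cb1; elim: n => [|n IHn]; first by rewrite mulr1.
by rewrite exprSr exprS -mulrA (mulrA c) cb1 mul1r.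
Qed.

Lemma principal_left_ideal {R : pzSemiRingType} (c : R) :
  left_ideal (fun x => exists r, x = r * c).
Proof.
split; [split|].
- by exists 0; rewrite mul0r.
- by move=> _ _ [r ->] [s ->]; exists (r + s); rewrite mulrDl.
- by move=> s _ [r ->]; exists (s * r); rewrite mulrA.
Qed.

Lemma left_artinian_mulr1C {R : pzSemiRingType} (b c : R) :
  left_artinian R -> c * b = 1 -> b * c = 1.
Proof.
move=> artR cb1.
have [||N stabN] := artR (fun n x => exists r, x = r * c ^+ n).
- by move=> n; apply: principal_left_ideal.
- by move=> n _ [r ->]; exists (r * c); rewrite exprS mulrA.
have [r cN] : exists r, c ^+ N = r * c ^+ N.+1.
  (* Equal sets give equal membership propositions, so it is enough to place [c ^+ N] in
     [R c ^+ N]. *)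
  have /(congr1 (fun I => I (c ^+ N))) /= -> := stabN _ (leqnSn N).
  by exists 1; rewrite mul1r.
have rc1 : r * c = 1.
  have := congr1 ( *%R^~ (b ^+ N)) cN.
  by rewrite /= exprS mulrA -mulrA expr_left_inverse // mulr1.
(* Both sides become [r * c], since [b * c = r * (c * b) * c]. *)
by rewrite -[b]mul1r -rc1 -(mulrA r) cb1 mulr1.
Qed.

(** Right ideals of [R] are left ideals of the opposite semiring [R^c], where [b] and [c] swap
    roles. *)
Lemma right_artinian_mulr1C {R : pzSemiRingType} (b c : R) :
  right_artinian R -> c * b = 1 -> b * c = 1.
Proof. exact: (@left_artinian_mulr1C R^c c b). Qed.

Lemma chain_two_sided_ideal {R : pzSemiRingType} (x : R) :
  total (@add_le R) -> ideal (fun y => exists a b, y = a * x * b).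
Proof.
move=> leR.
have addI : additive_submonoid (fun y => exists a b, y = a * x * b).
  split=> [|y z Iy Iz]; first by exists 0, 0; rewrite mulr0.
  by have /orP[/eqP->|/eqP] := leR y z; last rewrite addrC => ->.
split; split=> // r _ [a [b ->]].
- by exists (r * a), b; rewrite !mulrA.
- by exists a, (b * r); rewrite !mulrA.
Qed.

(** The ideal [RxR] contains [x = 1 * x * 1], so it is nonzero and must contain 1. *)
Lemma ideal_simple_mul1 {R : pzSemiRingType} {x : R} :
  total (@add_le R) -> ideal_simple R -> x != 0 ->
  exists a b, a * x * b = 1.
Proof.
move=> leR simpleR /eqP x0.
have [I0|IT] := simpleR _ (chain_two_sided_ideal x leR).
- have /(congr1 (fun I => I x)) /= xE := I0.
  by case: x0; rewrite -[x = 0]xE; exists 1, 1; rewrite mul1r mulr1.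
- have /(congr1 (fun I => I 1)) /= oneE := IT.
  have [a [b ab]] : exists a b, 1 = a * x * b by rewrite oneE.
  by exists a, b.
Qed.

(** If [x] in [I] has left inverse [y], every [z = z * (y * x)] lies in [I]. *)
Lemma division_ideal_simple {R : pzSemiRingType} :
  (forall x : R, x != 0 -> exists y, x * y = 1 /\ y * x = 1) ->
  ideal_simple R.
Proof.
move=> invR I [[[I0 _] mulI] _].
have [[x Ix x0]|noI] := pselect (exists2 x, I x & x != 0); [right|left].
- have [y [_ yx1]] := invR x x0.
  by apply/seteqP; split=> // z _; rewrite -[z]mulr1 -yx1; apply/(mulI)/(mulI).
- apply/seteqP; split=> [x Ix|_ ->] //=.
  by apply/eqP/negPn/negP => x0; apply: noI; exists x.
Qed.

Theorem theorem6p4 (R : pzSemiRingType) (aicR : aic_semiring R)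
    (artR : left_artinian R \/ right_artinian R) (R10 : 1 != 0 :> R) :
  ideal_simple R <-> division_aic_semiring R.
Proof.
split=> [simpleR|[_ invR]]; last exact: division_ideal_simple.
split=> // x x0.
have mulr1C (b c : R) : c * b = 1 -> b * c = 1.
  by case: artR => [/left_artinian_mulr1C|/right_artinian_mulr1C]; apply.
have [a [b axb1]] := ideal_simple_mul1 aicR.2 simpleR x0.
(* Bracket [a * x * b = 1] in two ways: [a * (x * b)] yields [x * b * a = 1], and [(a * x) * b]
   yields [b * (a * x) = 1]. *)
exists (b * a); split; last by rewrite -mulrA; apply: mulr1C.
by rewrite mulrA; apply: mulr1C; rewrite mulrA.
Qed.
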